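(* Let $G$ be a cubic graph. If $G \neq K_2^3$, then the following statements are equivalent. 1) $G$ has a $1$-factor. 2) $3 \in {\cal S}(G)$. 3) $3 \in \overline{{\cal S}}(G)$. 4) $4 \in \overline{{\cal S}}(G)$.
   Context: Graphs are finite and may have parallel edges but no loops. A $1$-factor is a spanning $1$-regular subgraph. $K_2^3$ is the cubic graph on two vertices which are connected by three parallel edges. A signed graph $(G,\sigma)$ is a graph $G$ with a function (signature) $\sigma: E(G)\to\{\pm1\}$. Each edge $e=uv$ is divided into two half-edges $h_e^u$ (incident with $u$) and $h_e^v$ (incident with $v$); $H(G)$ is the set of half-edges, $H(v)$ the set of half-edges incident with $v$, and $e_h$ the edge containing the half-edge $h$. An orientation of $(G,\sigma)$ is a function $\tau: H(G)\to\{\pm1\}$ with $\tau(h_e^u)\tau(h_e^v) = -\sigma(e)$ for each edge $e=uv$. Given an orientation $\tau$, the boundary of $f:E(G)\to\mathbb{R}$ is $\delta f(v)=\sum_{h\in H(v)}\tau(h)f(e_h)$. For real $r\ge 2$, $f$ is an $r$-flow on $(G,\sigma)$ if, for every edge $e$, $f(e)=0$ or $1\le |f(e)|\le r-1$, and $\delta f(v)=0$ for all $v\in V(G)$; it is nowhere-zero if $f(e)\ne 0$ for all $e$. $(G,\sigma)$ admits a nowhere-zero $r$-flow if one exists for some orientation, and $(G,\sigma)$ is flow-admissible if it admits a nowhere-zero $r$-flow for some $r\ge2$. $F_c((G,\sigma))=\inf\{r : (G,\sigma)\text{ admits a nowhere-zero }r\text{-flow}\}$, and $F((G,\sigma))$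 is the smallest integer $k$ such that $(G,\sigma)$ admits an integer-valued nowhere-zero $k$-flow (both are $\infty$ if $(G,\sigma)$ is not flow-admissible). The flow spectrum ${\cal S}(G)$ is the set of all $F_c((G,\sigma))$, and the integer flow spectrum $\overline{{\cal S}}(G)$ the set of all $F((G,\sigma))$, where $\sigma$ ranges over all signatures of $G$ for which $(G,\sigma)$ is flow-admissible.
   Formalization: Besides K_2^3, the empty graph and disjoint unions of two or more copies of K_2^3 are excluded, since the claim fails for them: for such unions every finite integer flow number is 3, so 1)-3) hold but 4) fails; the empty graph has a 1-factor but only flow number 2. *)

(* Defs.v *)
From HB Require Import structures.
From mathcomp Require Import all_boot all_order all_algebra.
From mathcomp Require Import all_classical all_reals ereal.

Set Implicit Arguments.
Unset Strict Implicit.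
Unset Printing Implicit Defensive.

Import Order.TTheory GRing.Theory Num.Theory.

Local Open Scope classical_set_scope.
Local Open Scope ring_scope.

(* Finite loopless multigraphs.  The two half-edges of e are (e, false) and
   (e, true); the half-edge h = (e, b) is incident with [gend e b].  Naming the
   ends of an edge by booleans does not orient it: isomorphisms may swap them. *)
Record graph := Graph {
  vertex : finType;
  edge : finType;
  gend : edge -> bool -> vertex;
  gloopless : forall e, gend e false != gend e true }.

Definition half_edge (G : graph) : finType := (edge G * bool)%type.

Definition half_edges_at (G : graph) (v : vertex G) : {set half_edge G} :=
  [set h : half_edge G | gend h.1 h.2 == v]%SET.

Definition edges_at (G : graph) (v : vertex G) : {set edge G} :=
  [set e : edge G | (gend e false == v) || (gend e true == v)]%SET.

Definition cubic (G : graph) : Prop :=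
  forall v : vertex G, #|edges_at v| = 3%N.

Definition one_factor (G : graph) (M : {set edge G}) : Prop :=
  forall v : vertex G, #|M :&: edges_at v| = 1%N.

Definition has_one_factor (G : graph) : Prop :=
  exists M : {set edge G}, one_factor M.

Definition ends (G : graph) (e : edge G) : {set vertex G} :=
  [set gend e false; gend e true]%SET.

Definition graph_iso (G H : graph) : Prop :=
  exists (phi : vertex G -> vertex H) (psi : edge G -> edge H),
    [/\ bijective phi, bijective psi
      & forall e : edge G, ends (psi e) = (phi @: ends e)%SET].

Lemma K23_loopless (e : 'I_3) : false != true.
Proof. by []. Qed.

(* The graph K_2^3. *)
Definition K23 : graph :=
  @Graph bool 'I_3 (fun _ b => b) K23_loopless.

Definition copies_end (n : nat) (G : graph) (e : 'I_n * edge G) (b : bool) :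
  'I_n * vertex G := (e.1, gend e.2 b).

Lemma copies_loopless n G (e : 'I_n * edge G) :
  copies_end e false != copies_end e true.
Proof. by rewrite /copies_end xpair_eqE eqxx /= gloopless. Qed.

(* The disjoint union of n copies of G. *)
Definition copies (n : nat) (G : graph) : graph :=
  @Graph ('I_n * vertex G)%type ('I_n * edge G)%type
         (@copies_end n G) (@copies_loopless n G).

Definition is_signature (G : graph) (sigma : edge G -> int) : Prop :=
  forall e, sigma e = 1 \/ sigma e = -1.

Definition is_orientation (G : graph) (sigma : edge G -> int)
    (tau : half_edge G -> int) : Prop :=
  (forall h, tau h = 1 \/ tau h = -1) /\
  (forall e, tau (e, false) * tau (e, true) = - sigma e).

Section Flows.
Variables (R : realType) (G : graph).
Implicit Types (sigma : edge G -> int) (tau : half_edge G -> int).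
Implicit Types (f : edge G -> R) (r : R).

Definition boundary tau f (v : vertex G) : R :=
  \sum_(h in half_edges_at v) (tau h)%:~R * f h.1.

Definition is_flow tau r f : Prop :=
  (forall e, f e = 0 \/ 1 <= `|f e| <= r - 1) /\
  (forall v, boundary tau f v = 0).

Definition nowhere_zero f : Prop := forall e, f e != 0.

Definition integer_valued f : Prop := forall e, f e \is a Num.int.

Definition admits_nz_flow sigma r : Prop :=
  2 <= r /\
  exists tau f, [/\ is_orientation sigma tau, is_flow tau r f
                  & nowhere_zero f].

Definition admits_int_nz_flow sigma (k : nat) : Prop :=
  2 <= k%:R :> R /\
  exists tau f, [/\ is_orientation sigma tau, is_flow tau k%:R f,
                    nowhere_zero f & integer_valued f].

Definition flow_admissible sigma : Prop := exists r, admits_nz_flow sigma r.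

(* F_c; the infimum of the empty set is +oo. *)
Definition circular_flow_number sigma : \bar R :=
  ereal_inf [set r%:E | r in [set r : R | admits_nz_flow sigma r]].

(* F((G, sigma)) = k, for finite k. *)
Definition is_integer_flow_number sigma (k : nat) : Prop :=
  admits_int_nz_flow sigma k /\
  forall j : nat, admits_int_nz_flow sigma j -> (k <= j)%N.

Definition flow_spectrum : set R :=
  [set x | exists sigma, [/\ is_signature sigma, flow_admissible sigma
                           & circular_flow_number sigma = x%:E]].

Definition integer_flow_spectrum : set nat :=
  [set k | exists sigma, [/\ is_signature sigma, flow_admissible sigma
                           & is_integer_flow_number sigma k]].

End Flows.
Arguments flow_spectrum : clear implicits.
Arguments integer_flow_spectrum : clear implicits.

(* Main.v *)
Require Import Defs.
From mathcomp Require Import all_boot all_order all_algebra.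
From mathcomp Require Import all_classical all_reals ereal.
From mathcomp Require Import lra zify.

Set Implicit Arguments.
Unset Strict Implicit.
Unset Printing Implicit Defensive.

Import Order.TTheory GRing.Theory Num.Theory.

Local Open Scope classical_set_scope.
Local Open Scope ring_scope.

(** Every implication passes through a 1-factor.

    From flows to 1-factors.  At a vertex of a cubic graph the three signed
    flow values sum to zero, so the largest absolute value is the sum of the
    two others (zero_sum3).  If all of them lie in [1, 3), exactly one is at
    least 2; if all of them are integers in [1, 3], parity shows that exactly
    one is even.  Either way the distinguished edges form a 1-factor.  As a
    flow number 3 is an infimum less than 4, it need not be attained for this
    argument to apply.

    From 1-factors to flow number 3.  With all edges negative, value 2 on a
    1-factor M and 1 elsewhere is a flow, and the sum relation at a vertex
    shows that no r-flow with r < 3 exists on any signature.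

    From 1-factors to integer flow number 4.  Put 2 on M, 3 on one edge e0
    outside M and 1 elsewhere, and read the signature off from the
    orientation that balances this: it is positive exactly on the edges of M
    with one end on e0 (switch_set M e0).  A signature with a 3-flow is
    switching equivalent to the all-negative one, so its positive edges form
    an edge cut (cut_of_flow_le3).  It remains to find M and e0 such that
    switch_set M e0 is not an edge cut.

    Suppose that it is always a cut.  For x an end of e0 = xy, the switch set
    consists of the M-edges m x and m y at x and y.  If x had two distinct
    neighbours y, z outside M, the intersection of the sides away from x of
    the cuts {m x, m y} and {m x, m z} would have m x as its only boundary
    edge (nonfactor_edges_parallel).  No M-edge can be a bridge: inside a smallest side S of such a bridge
    m x, a neighbour y of x outside M again has a bridge m y, because
    {m x, m y} is a cut, and m y cuts off a smaller part of S
    (factor_edge_not_bridge).  Hence the two edges outside M at each vertex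
    are parallel.  Exchanging M for a 1-factor that contains one of these two
    edges and applying the same conclusion, all three edges at each vertex are
    parallel, so G is a disjoint union of copies of K_2^3. *)

Lemma bij_of_inj_surj (A B : Type) (f : A -> B) :
  injective f -> (forall y, exists x, f x = y) ->
  exists g, cancel f g /\ cancel g f.
Proof.
move=> f_inj /choice[g fK]; exists g; split=> // x.
by apply: f_inj; rewrite fK.
Qed.

(** * Incidence and edge cuts *)

Section Incidence.
Variable G : graph.
Implicit Types (e : edge G) (u v : vertex G) (M : {set edge G})
  (S T : {set vertex G}).

Lemma mem_edges_at v e :
  (e \in edges_at v) = (gend e false == v) || (gend e true == v).
Proof. by rewrite inE. Qed.

Lemma gend_edges_at e b : e \in edges_at (gend e b).
Proof. by rewrite mem_edges_at; case: b; rewrite eqxx ?orbT. Qed.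

(** The name of the half-edge of e at v; it is meaningful when e is incident
    with v. *)
Definition side v e : bool := gend e true == v.

Lemma gend_side v e : e \in edges_at v -> gend e (side v e) = v.
Proof.
rewrite mem_edges_at /side; case: (eqVneq (gend e true) v) => //= _.
by rewrite orbF => /eqP.
Qed.

Lemma side_gend e b : side (gend e b) e = b.
Proof.
by rewrite /side; case: b; rewrite ?eqxx // eq_sym (negPf (gloopless e)).
Qed.

Definition other_end e v := gend e (~~ side v e).

Lemma other_end_neq e v : e \in edges_at v -> other_end e v != v.
Proof.
move=> ev; rewrite /other_end -{2}(gend_side ev).
by case: (side v e); rewrite /= ?gloopless // eq_sym gloopless.
Qed.

Lemma other_end_edges_at e v : e \in edges_at (other_end e v).
Proof. exact: gend_edges_at. Qed.

Lemma other_endP e u v :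
  e \in edges_at u -> e \in edges_at v -> u != v -> u = other_end e v.
Proof.
move=> /gend_side <- /gend_side {1}<-; rewrite /other_end.
by case: (side u e); case: (side v e); rewrite ?eqxx.
Qed.

Lemma endsE e v : e \in edges_at v -> ends e = [set v; other_end e v]%SET.
Proof.
move=> ev; rewrite /ends /other_end -{1}(gend_side ev).
by case: (side v e) => //=; rewrite finset.setUC.
Qed.

Lemma mem_ends v e : (v \in ends e) = (e \in edges_at v).
Proof. by rewrite !inE !(eq_sym v). Qed.

Definition in_cut S e := (gend e false \in S) (+) (gend e true \in S).

Lemma in_cut_other_end S e v :
  e \in edges_at v -> in_cut S e = (v \in S) (+) (other_end e v \in S).
Proof.
move=> ev; rewrite /in_cut /other_end -{1}(gend_side ev).
by case: (side v e) => //=; rewrite addbC.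
Qed.

Lemma in_cutC S e : in_cut (~: S)%SET e = in_cut S e.
Proof. by rewrite /in_cut !inE; do 2 case: (_ \in S). Qed.

Lemma in_cut_symdiff S T e :
  in_cut [set v | (v \in S) (+) (v \in T)]%SET e = in_cut S e (+) in_cut T e.
Proof. by rewrite /in_cut !inE; do 2 case: (_ \in S); do 2 case: (_ \in T). Qed.

(** The boundary of an intersection of two sides is determined by the two cuts
    and the position of one end of the edge. *)
Lemma in_cutI S T e v : e \in edges_at v ->
  in_cut (S :&: T)%SET e =
    if v \in S then
      if v \in T then in_cut S e || in_cut T e else ~~ in_cut S e && in_cut T e
    else (if v \in T then in_cut S e && ~~ in_cut T e
          else in_cut S e && in_cut T e).
Proof.
move=> ev; rewrite !(in_cut_other_end _ ev) !inE.
by do 2 case: (_ \in S); do 2 case: (_ \in T).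
Qed.

(** A 1-factor as a function, so that its edges can be compared as values. *)
Lemma one_factor_matched M : one_factor M ->
  exists m : vertex G -> edge G,
    forall v e, (e \in M) && (e \in edges_at v) = (e == m v).
Proof.
move=> hM.
suff /choice[m mP] : forall v, exists e0, forall e,
    (e \in M) && (e \in edges_at v) = (e == e0) by exists m.
move=> v; have /eqP/cards1P[e0 he0] := hM v.
by exists e0 => e; rewrite -finset.in_setI he0 inE.
Qed.

End Incidence.

(** * One-factors all of whose switch sets are cuts *)

Section Cuts.
Variables (G : graph) (M : {set edge G}).
Hypotheses (G_cubic : cubic G) (M_factor : one_factor M).
Implicit Types (e : edge G) (x y z v : vertex G) (S T : {set vertex G}).

(** The positive edges of the signature of the 4-flow built from M and e0. *)
Definition switch_set (e0 e : edge G) : bool :=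
  (e \in M) && ((gend e false \in ends e0) (+) (gend e true \in ends e0)).

Hypothesis all_cuts :
  forall e0, e0 \notin M -> exists S, forall e, in_cut S e = switch_set e0 e.

Section WithMatching.
Variable m : vertex G -> edge G.
Hypothesis mP : forall v e, (e \in M) && (e \in edges_at v) = (e == m v).

Lemma matched_in v : m v \in M.
Proof. by have := mP v (m v); rewrite eqxx => /andP[]. Qed.

Lemma matched_at v : m v \in edges_at v.
Proof. by have := mP v (m v); rewrite eqxx => /andP[]. Qed.

Lemma matched_uniq v e : e \in M -> e \in edges_at v -> e = m v.
Proof. by move=> eM ev; apply/eqP; rewrite -mP eM. Qed.

Lemma matched_neq v e : e \notin M -> (e == m v) = false.
Proof. by move=> eM; rewrite -mP (negPf eM). Qed.

(** The exclusive or covers the case of e0 parallel to an edge of M, where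
    both ends of e0 have the same M-edge and the switch set is empty. *)
Lemma switch_setE e0 x e : e0 \in edges_at x ->
  switch_set e0 e = (e == m x) (+) (e == m (other_end e0 x)).
Proof.
move=> e0x; rewrite -!mP /switch_set !mem_edges_at (endsE e0x) !inE.
case: (e \in M) => //=.
have h3 (a b : vertex G) : a != b -> forall c, ~~ ((c == a) && (c == b)).
  by move=> ab c; apply: contra ab => /andP[/eqP<- /eqP<-].
have := h3 _ _ (gloopless e); have := h3 _ _ (other_end_neq e0x).
set y := other_end e0 x => hxy hpq.
move: (hxy (gend e false)) (hxy (gend e true)) (hpq x) (hpq y).
rewrite ![x == _]eq_sym ![y == _]eq_sym.
by do 4 case: (_ == _).
Qed.

(** A side of a cut can be replaced by its complement, so a chosen vertex may
    be assumed outside. *)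
Lemma pair_cut e0 x : e0 \notin M -> e0 \in edges_at x ->
  exists2 S : {set vertex G}, x \notin S
    & forall e, in_cut S e = (e == m x) (+) (e == m (other_end e0 x)).
Proof.
move=> e0M e0x; have [S hS] := all_cuts e0M.
have hS' e : in_cut S e = (e == m x) (+) (e == m (other_end e0 x)).
  by rewrite hS (switch_setE _ e0x).
have [xS|xS] := boolP (x \in S); last by exists S.
by exists (~: S)%SET => [|e]; rewrite ?inE ?xS // in_cutC.
Qed.

Lemma nonfactor_edge_at v : exists2 e, e \notin M & e \in edges_at v.
Proof.
have : (0 < #|edges_at v :\: M|)%N.
  by rewrite cardsD G_cubic finset.setIC M_factor.
by case/card_gt0P => e; rewrite inE => /andP[]; exists e.
Qed.

(** Descent on the size of a side of the bridge. If S is a side of the bridge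
    m x and y is a neighbour of x outside M, then combining S with the cut
    {m x, m y} shows that m y is a bridge as well; its side away from x,
    intersected with S, is a side of m y without x. *)
Lemma factor_edge_not_bridge S e0 :
  e0 \in M -> (forall e, in_cut S e = (e == e0)) -> False.
Proof.
have [n] := ubnP #|S|; elim: n S e0 => // n IHn S e0 leSn e0M hS.
have [x xS e0x] : exists2 x, x \in S & e0 \in edges_at x.
  have := hS e0; rewrite eqxx /in_cut.
  have [|] := boolP (gend e0 false \in S) => h /= h'.
    by exists (gend e0 false); rewrite ?gend_edges_at.
  by exists (gend e0 true); rewrite ?gend_edges_at.
have {e0x} e0E := matched_uniq e0M e0x; subst e0.
have [f fM fx] := nonfactor_edge_at x; pose y := other_end f x.
have fy : f \in edges_at y := other_end_edges_at f x.
have yx : y != x := other_end_neq fx.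
(* y lies in S, as an edge outside M is not cut by S *)
have yS : y \in S.
  by have := hS f; rewrite matched_neq // (in_cut_other_end _ fx) xS -/y /=;
    case: (y \in S).
have mxy : m y != m x.
  apply: contraTneq yS => myx.
  have yE : y = other_end (m x) x by apply: other_endP => //;
    rewrite ?matched_at // -myx matched_at.
  by have := hS (m x); rewrite eqxx (in_cut_other_end _ (matched_at x)) xS -yE.
have [S1 xS1 hS1] := pair_cut fM fx; rewrite -/y in hS1.
(* {m x} and {m x, m y} are cuts, so their symmetric difference {m y} is one *)
pose T0 := [set v | (v \in S) (+) (v \in S1)]%SET.
have hT0 e : in_cut T0 e = (e == m y).
  by rewrite in_cut_symdiff hS hS1 addbA addbb.
have [T hT yT] : exists2 T : {set vertex G},
    (forall e, in_cut T e = (e == m y)) & y \notin T.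
  have [yT|yT] := boolP (y \in T0); last by exists T0.
  by exists (~: T0)%SET => [e|]; rewrite ?in_cutC // inE yT.
have xT : x \notin T.
  by have := hT f; rewrite matched_neq // (in_cut_other_end _ fy) (negPf yT)
    -(other_endP fx fy) 1?eq_sym //= => ->.
apply: (IHn (S :&: T)%SET (m y)); last 2 first.
- exact: matched_in.
- move=> e; have [eM|eM] := boolP (e \in M); last first.
    rewrite (in_cutI _ _ (gend_edges_at e false)) hS hT !matched_neq //.
    by do 2 case: ifP.
  have [->|ny] := eqVneq e (m y).
    by rewrite (in_cutI _ _ (matched_at y)) hS hT eqxx yS (negPf yT) mxy.
  have [->|nx] := eqVneq e (m x).
    by rewrite (in_cutI _ _ (matched_at x)) hS hT eqxx xS (negPf xT).
  by rewrite (in_cutI _ _ (gend_edges_at e false)) hS hT (negPf nx)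
    (negPf ny); do 2 case: ifP.
- rewrite -ltnS; apply: leq_trans leSn; rewrite ltnS; apply: proper_card.
  by apply/fintype.properP; split; [exact: finset.subsetIl | exists x;
    rewrite ?inE ?(negPf xT) ?andbF].
Qed.

(** If m x joined x to the end y of e, it would be cut by a set that cuts no
    edge outside M, in particular not the edge e, which has the same ends. *)
Lemma distinct_matching_edges e f x :
    e \notin M -> f \notin M -> e \in edges_at x -> f \in edges_at x ->
    other_end e x != other_end f x -> m x != m (other_end e x).
Proof.
set y := other_end e x; set z := other_end f x => eM fM ex fx yz.
have yx : y != x := other_end_neq ex; have zx : z != x := other_end_neq fx.
apply/eqP => mxy.
have yE : y = other_end (m x) x by apply: other_endP;
  rewrite ?matched_at // mxy matched_at.
have mxz : m x != m z.
  apply: contraNneq yz => mxz; rewrite yE eq_sym; apply/eqP.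
  by apply: other_endP; rewrite ?matched_at // mxz matched_at.
have [S xS hS] := pair_cut fM fx.
have := hS e; rewrite !matched_neq // (in_cut_other_end _ ex) (negPf xS) /=
  -/y => yS.
by have := hS (m x); rewrite eqxx (negPf mxz)
  (in_cut_other_end _ (matched_at x)) (negPf xS) -yE yS.
Qed.

(** For distinct y and z, intersecting the sides away from x of the cuts
    {m x, m y} and {m x, m z} keeps only m x on the boundary, which makes m x
    a bridge. *)
Lemma nonfactor_edges_parallel e f x : e \notin M -> f \notin M ->
  e \in edges_at x -> f \in edges_at x -> other_end e x = other_end f x.
Proof.
move=> eM fM ex fx; apply/eqP/negPn/negP => yz.
have mxy := distinct_matching_edges eM fM ex fx yz.
have mxz : m x != m (other_end f x).
  by apply: (@distinct_matching_edges f e) => //; rewrite eq_sym.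
have [S1 xS1 hS1] := pair_cut eM ex; have [S2 xS2 hS2] := pair_cut fM fx.
set y := other_end e x in yz mxy hS1; set z := other_end f x in yz mxz hS2.
have yS v T : v \in [:: y; z] -> x \notin T ->
    (forall e', e' \notin M -> in_cut T e' = false) -> v \notin T.
  move=> vyz xT hT; have {vyz} [g gM [gx ->]] :
      exists2 g, g \notin M & g \in edges_at x /\ v = other_end g x.
    by move: vyz; rewrite !inE => /orP[]/eqP->; [exists e | exists f].
  by have := hT _ gM; rewrite (in_cut_other_end _ gx) (negPf xT) /= => ->.
have n1 e' : e' \notin M -> in_cut S1 e' = false by move=> h;
  rewrite hS1 !matched_neq.
have n2 e' : e' \notin M -> in_cut S2 e' = false by move=> h;
  rewrite hS2 !matched_neq.
have yS1 : y \notin S1 by apply: yS; rewrite ?inE ?eqxx.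
have zS1 : z \notin S1 by apply: yS; rewrite ?inE ?eqxx ?orbT.
have yS2 : y \notin S2 by apply: yS; rewrite ?inE ?eqxx.
have zS2 : z \notin S2 by apply: yS; rewrite ?inE ?eqxx ?orbT.
(* otherwise m y joins y to z, which lie on the same side of S1 *)
have myz : m y != m z.
  apply/eqP => myz; have := hS1 (m y); rewrite eqxx eq_sym (negPf mxy).
  have zE : z = other_end (m y) y by apply: other_endP;
    rewrite ?matched_at 1?eq_sym // myz matched_at.
  by rewrite (in_cut_other_end _ (matched_at y)) -zE (negPf yS1) (negPf zS1).
apply: (@factor_edge_not_bridge (S1 :&: S2)%SET (m x) (matched_in x)) => e'.
have [->|nx] := eqVneq e' (m x).
  by rewrite (in_cutI _ _ (matched_at x)) hS1 hS2 eqxx (negPf mxy) (negPf mxz)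
    (negPf xS1) (negPf xS2).
have [->|ny] := eqVneq e' (m y).
  by rewrite (in_cutI _ _ (matched_at y)) hS1 hS2 eqxx (negPf myz) eq_sym
    (negPf mxy) (negPf yS1) (negPf yS2).
have [->|nz] := eqVneq e' (m z).
  rewrite (in_cutI _ _ (matched_at z)) hS1 hS2 eqxx ![m z == _]eq_sym
    (negPf myz).
  by rewrite (negPf mxz) (negPf zS1) (negPf zS2).
rewrite (in_cutI _ _ (gend_edges_at e' false)) hS1 hS2.
by rewrite (negPf nx) (negPf ny) (negPf nz); do 2 case: ifP.
Qed.

End WithMatching.
End Cuts.

(** * Reduction to copies of K_2^3 *)

(** By nonfactor_edges_parallel the edges outside M come in parallel pairs.
    Selecting one edge of each pair gives a second 1-factor M', for which the
    edges outside M' at v are m v and the other edge of the pair. These are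
    parallel too. *)
Lemma edges_at_parallel G : cubic G ->
  (forall M : {set edge G}, one_factor M -> forall e0, e0 \notin M ->
    exists S, forall e, in_cut S e = switch_set M e0 e) ->
  has_one_factor G ->
  forall (v : vertex G) e f,
    e \in edges_at v -> f \in edges_at v -> ends e = ends f.
Proof.
move=> G_cubic all_cuts [M M_factor].
have [m mP] := one_factor_matched M_factor.
have oppM := nonfactor_edges_parallel G_cubic M_factor (all_cuts _ M_factor) mP.
(* pick depends only on the set of candidates, so the two parallel edges of
   a pair select the same representative *)
pose par e := [pick e' | (e' \notin M) && (ends e' == ends e)].
pose M' := [set e | (e \notin M) && (par e == Some e)]%SET.
have M'P v : exists2 e1, e1 \in edges_at v &
    forall e, e \in edges_at v -> (e \in M') = (e == e1).
  have [e0 e0M e0v] := nonfactor_edge_at G_cubic M_factor v.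
  have parE e : e \in edges_at v -> e \notin M -> par e = par e0.
    move=> ev eM; apply: eq_pick => e'.
    by rewrite (endsE ev) (endsE e0v) (oppM _ _ _ eM e0M ev e0v).
  have : par e0 = par e0 by [].
  rewrite {1}/par; case: pickP => [e1 /andP[e1M /eqP e1e0] pe0|/(_ e0)];
    last first.
    by rewrite e0M eqxx.
  have e1v : e1 \in edges_at v by rewrite -mem_ends e1e0 mem_ends.
  exists e1 => // e ev; rewrite inE; have [->|ne] := eqVneq e e1.
    by rewrite e1M parE // -pe0 eqxx.
  apply/negbTE; rewrite negb_and negbK; have [//|eM /=] := boolP (e \in M).
  by rewrite parE // -pe0; apply: contra ne => /eqP[->].
have M'_factor : one_factor M'.
  move=> v; have [e1 e1v e1P] := M'P v; apply/eqP/cards1P; exists e1.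
  apply/setP => e; rewrite !inE -[(_ == v) || _]mem_edges_at.
  have [ev|ev] := boolP (e \in edges_at v); last first.
    by rewrite andbF; apply/esym/eqP => eE; rewrite eE e1v in ev.
  by rewrite andbT -e1P // inE.
have [m' m'P] := one_factor_matched M'_factor.
have oppM' := nonfactor_edges_parallel G_cubic M'_factor
  (all_cuts _ M'_factor) m'P.
move=> v.
have mvM' : m v \notin M' by rewrite inE matched_in.
suff vP : forall e, e \in edges_at v -> other_end e v = other_end (m v) v.
  by move=> e f ev fv; rewrite (endsE ev) (endsE fv) !vP.
have [e1 e1v e1P] := M'P v.
have [e2 e2v /andP[e2M e2M']] : exists2 e2, e2 \in edges_at v &
    (e2 \notin M) && (e2 \notin M').
  have [/exists_inP[e2 ? ?]|/exists_inPn h] :=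
    boolP [exists e2 in edges_at v, (e2 \notin M) && (e2 \notin M')].
    by exists e2.
  have : (#|edges_at v| <= #|[set m v; e1]%SET|)%N.
    apply/subset_leq_card/fintype.subsetP => e ev; rewrite !inE -e1P // -mP ev.
    by have := h e ev; rewrite negb_and !negbK andbT.
  by rewrite G_cubic leqNgt cards2; case: (_ != _).
have e2m : other_end e2 v = other_end (m v) v by apply: oppM';
  rewrite ?(matched_at mP).
move=> e ev; have [eM|eM] := boolP (e \in M);
  first by rewrite -(matched_uniq mP eM ev).
by rewrite -e2m; apply: oppM.
Qed.

(** The edges of M index the copies: each component is spanned by the two ends
    of one of them. *)
Lemma iso_copies G (M : {set edge G}) : cubic G -> one_factor M ->
  (forall (v : vertex G) e f,
    e \in edges_at v -> f \in edges_at v -> ends e = ends f) ->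
  graph_iso G (copies #|M| K23).
Proof.
move=> G_cubic M_factor par; have [m mP] := one_factor_matched M_factor.
pose fv (p : 'I_#|M| * bool) : vertex G := gend (enum_val p.1) p.2.
pose fe (p : 'I_#|M| * 'I_3) : edge G :=
  enum_val (cast_ord (esym (G_cubic (fv (p.1, false)))) p.2).
have val_m i b : enum_val i = m (fv (i, b)).
  by apply: (matched_uniq mP); rewrite ?enum_valP ?gend_edges_at.
have fe_at p : fe p \in edges_at (fv (p.1, false)) by exact: enum_valP.
have ends_fe p : ends (fe p) = ends (enum_val p.1).
  by apply: par (fe_at p) _; exact: gend_edges_at.
have fv_inj : injective fv.
  case=> i b [j c] E; have ij : i = j.
    by apply: enum_val_inj; rewrite (val_m i b) (val_m j c) E.
  subst j; congr pair; move: E; rewrite /fv /=.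
  have := gloopless (enum_val i).
  by case: b; case: c => //= /eqP h // /esym.
have fv_surj v : exists p, fv p = v.
  exists (enum_rank_in (matched_in mP v) (m v), side v (m v)).
  rewrite /fv /= enum_rankK_in ?(matched_in mP) // gend_side //.
  exact: matched_at mP _.
have fe_inj : injective fe.
  case=> i k [j l] E; have ij : i = j.
    have : fv (i, false) \in ends (fe (i, k)) by rewrite mem_ends fe_at.
    rewrite E ends_fe /= mem_ends => h.
    apply: enum_val_inj; rewrite (val_m i false);
      apply/esym/(matched_uniq mP) => //.
    exact: enum_valP.
  by subst j; congr pair; move/enum_val_inj/cast_ord_inj: E.
have fe_surj e : exists p, fe p = e.
  pose v := gend e false; have [[i b] vE] := fv_surj v.
  have ev : e \in edges_at (fv (i, false)).
    rewrite -mem_ends (par v e (enum_val i)) ?gend_edges_at //.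
      by rewrite mem_ends gend_edges_at.
    by rewrite -vE gend_edges_at.
  exists (i, cast_ord (G_cubic _) (enum_rank_in ev e)).
  by rewrite /fe /= cast_ordK enum_rankK_in.
have [phi [fvK phiK]] := bij_of_inj_surj fv_inj fv_surj.
have [psi [feK psiK]] := bij_of_inj_surj fe_inj fe_surj.
exists phi, psi; split; [by exists fv | by exists fe | move=> e].
rewrite -[e in RHS]psiK ends_fe; case: (psi e) => i k /=.
by rewrite /ends imsetU !imset_set1 -![gend (enum_val i) _]/(fv (i, _)) !fvK.
Qed.

Lemma iso_copies1 G : graph_iso G (copies 1 K23) -> graph_iso G K23.
Proof.
move=> [phi [psi [phi_bij psi_bij h]]].
have snd_bij T : bijective (fun p : 'I_1 * T => p.2).
  by exists (fun x => (ord0, x)) => // -[i x]; rewrite (ord1 i).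
exists (fun v => (phi v).2), (fun e => (psi e).2); split.
- exact: bij_comp (snd_bij _) phi_bij.
- exact: bij_comp (snd_bij _) psi_bij.
move=> e.
have -> : ((fun v => (phi v).2) @: ends e = snd @: (phi @: ends e))%SET.
  by rewrite -imset_comp.
by rewrite -h /ends imsetU !imset_set1.
Qed.

Lemma exists_uncut_switch_set G : cubic G ->
  ~ graph_iso G K23 ->
  (forall n : nat, n <> 1%N -> ~ graph_iso G (copies n K23)) ->
  has_one_factor G ->
  exists (M : {set edge G}) e0, [/\ one_factor M, e0 \notin M
    & forall S : {set vertex G}, ~ forall e, in_cut S e = switch_set M e0 e].
Proof.
move=> G_cubic notK23 notcopies G_factor; apply: contrapT => none.
have [M M_factor] := G_factor.
have G_iso : graph_iso G (copies #|M| K23).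
  apply: (iso_copies G_cubic M_factor); apply: edges_at_parallel =>
    // M' M'_factor e0 e0M'.
  by apply: contrapT => noS; apply: none; exists M', e0; split=> // S hS;
    apply: noS; exists S.
have [cardM1|/eqP cardM1] := eqVneq #|M| 1%N;
  last exact: notcopies cardM1 G_iso.
by apply/notK23/iso_copies1; rewrite -cardM1.
Qed.

(** * Flow values around a vertex *)

Section ZeroSums.
Variable R : realDomainType.
Implicit Types a b c : R.

(** The sign conditions record that a is opposite to both b and c. *)
Definition dominates a b c :=
  [/\ `|a| = `|b| + `|c|, (0 < b) = ~~ (0 < a) & (0 < c) = ~~ (0 < a)].

Lemma zero_sum3 a b c : a != 0 -> b != 0 -> c != 0 -> a + b + c = 0 ->
  [\/ dominates a b c, dominates b a c | dominates c a b].
Proof.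
rewrite /dominates.
case: (ltrgt0P a) => // ha _; case: (ltrgt0P b) => // hb _;
  case: (ltrgt0P c) => // hc _ h.
- by exfalso; lra.
- by constructor 3; split=> //; lra.
- by constructor 2; split=> //; lra.
- by constructor 1; split=> //; lra.
- by constructor 1; split=> //; lra.
- by constructor 2; split=> //; lra.
- by constructor 3; split=> //; lra.
- by exfalso; lra.
Qed.

End ZeroSums.

(** * From flows to one-factors and cuts *)

Section Flows.
Variables (R : realType) (G : graph).
Hypothesis G_cubic : cubic G.
Implicit Types (sigma : edge G -> int) (tau : half_edge G -> int).
Implicit Types (f : edge G -> R) (r : R) (e : edge G) (v : vertex G).

Lemma boundaryE tau f v :
  boundary tau f v = \sum_(e in edges_at v) (tau (e, side v e))%:~R * f e.
Proof.
rewrite /boundary (reindex_onto (fun e => (e, side v e)) fst) /=; last first.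
  by move=> [e b]; rewrite inE /= => /eqP<-; rewrite side_gend.
apply: eq_bigl => e; rewrite inE /= eqxx andbT.
apply/eqP/idP => [<-|/gend_side//]; exact: gend_edges_at.
Qed.

Lemma three_edges v : exists e1 e2 e3,
  uniq [:: e1; e2; e3] /\ edges_at v =i [:: e1; e2; e3].
Proof.
have := G_cubic v; rewrite cardE => hs.
have hi := mem_enum (edges_at v); have hu := enum_uniq (edges_at v).
case: (enum _) hs hi hu => [|e1 [|e2 [|e3 []]]] //= _ hi hu.
by exists e1, e2, e3; split=> // e; rewrite -hi.
Qed.

Lemma one_factor_three_edges (M : {set edge G}) :
  (forall v e1 e2 e3, uniq [:: e1; e2; e3] ->
     edges_at v =i [:: e1; e2; e3] ->
     ((e1 \in M) + (e2 \in M) + (e3 \in M) = 1)%N) <->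
  one_factor M.
Proof.
suff cardM v e1 e2 e3 : uniq [:: e1; e2; e3] ->
    edges_at v =i [:: e1; e2; e3] ->
    #|M :&: edges_at v| = ((e1 \in M) + (e2 \in M) + (e3 \in M))%N.
  split=> h v; last by move=> e1 e2 e3 hu hv; rewrite -(cardM v).
  by have [e1 [e2 [e3 [hu hv]]]] := three_edges v;
    rewrite (cardM _ e1 e2 e3) ?(h v).
move=> hu hv; rewrite -sum1_card
  (eq_bigl (fun e => (e \in [:: e1; e2; e3]) && (e \in M))).
  rewrite big_mkcondr -big_uniq //= !big_cons big_nil.
  by do 3 case: (_ \in M).
by move=> e; rewrite finset.in_setI hv andbC.
Qed.

Lemma boundary_three_edges tau f v e1 e2 e3 : uniq [:: e1; e2; e3] ->
  edges_at v =i [:: e1; e2; e3] ->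
  boundary tau f v =
    (tau (e1, side v e1))%:~R * f e1 + (tau (e2, side v e2))%:~R * f e2 +
    (tau (e3, side v e3))%:~R * f e3.
Proof.
move=> hu hv; rewrite boundaryE (eq_bigl _ _ hv) -big_uniq //.
by rewrite !big_cons big_nil /= addr0 addrA.
Qed.

Lemma norm_sign tau f h e : (forall h, tau h = 1 \/ tau h = -1) ->
  `|(tau h)%:~R * f e| = `|f e|.
Proof. by move=> /(_ h)[]->; rewrite ?mulrN1z ?mul1r ?mulN1r ?normrN. Qed.

Definition inflow tau f v e : R := (tau (e, side v e))%:~R * f e.

Lemma flow_dominates sigma tau r f :
  is_orientation sigma tau -> is_flow tau r f -> nowhere_zero f -> forall v e1 e2 e3, uniq [:: e1; e2; e3] ->
  edges_at v =i [:: e1; e2; e3] ->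
  let g := inflow tau f v in
  [/\ forall e, 1 <= `|g e| /\ `|g e| <= r - 1, forall e, `|g e| = `|f e|
    & [\/ dominates (g e1) (g e2) (g e3), dominates (g e2) (g e1) (g e3)
       | dominates (g e3) (g e1) (g e2)]].
Proof.
move=> [tau1 _] [fr f0] fnz v e1 e2 e3 hu hv g.
have gf e : `|g e| = `|f e| by exact: norm_sign.
have g0 e : g e != 0 by rewrite -normr_gt0 gf normr_gt0.
split=> // [e|]; last by apply: zero_sum3;
  rewrite // -(boundary_three_edges tau f hu hv).
by rewrite gf; have := fnz e; case: (fr e) => [->|/andP]; rewrite ?eqxx.
Qed.

Lemma nz_flow_ge3 sigma r v : admits_nz_flow sigma r -> 3 <= r.
Proof.
move=> [_ [tau [f [tauP fP fnz]]]].
have [e1 [e2 [e3 [hu hv]]]] := three_edges v.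
have [+ _] := flow_dominates tauP fP fnz hu hv.
move=> /all_and2[g1 gr] h.
by case: h => -[h _ _]; move: (g1 e1) (g1 e2) (g1 e3) (gr e1) (gr e2) (gr e3);
  rewrite h; lra.
Qed.

(** A sum of two values in [1, 3) which is itself less than 3 has both terms
    below 2, so the edges with |f| >= 2 are one at each vertex. *)
Lemma one_factor_of_flow_lt4 sigma r :
  admits_nz_flow sigma r -> r < 4 -> has_one_factor G.
Proof.
move=> [_ [tau [f [tauP fP fnz]]]] r4.
exists [set e | 2 <= `|f e|]%SET; apply/one_factor_three_edges =>
  v e1 e2 e3 hu hv.
have [+ gf] := flow_dominates tauP fP fnz hu hv; rewrite !inE -!gf.
move=> /all_and2[g1 gr] h.
have [b1 b2 b3] := And3 (g1 e1) (g1 e2) (g1 e3).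
have [t1 t2 t3] := And3 (gr e1) (gr e2) (gr e3).
have big (x y z : R) : x = y + z -> 1 <= y -> 1 <= z -> x <= r - 1 ->
    ((2 <= x) = true) * ((2 <= y) = false) * ((2 <= z) = false).
  by move=> *; do !split; first [apply/idP; lra | apply/negbTE;
    rewrite -ltNge; lra].
by case: h => -[h _ _]; rewrite !(big _ _ _ h).
Qed.

(** The sum relation a = b + c in [1, 3] is 2 = 1 + 1, 3 = 1 + 2 or
    3 = 2 + 1, each with a single 2. *)
Lemma one_factor_of_int_flow_le4 sigma k :
  admits_int_nz_flow R sigma k -> (k <= 4)%N -> has_one_factor G.
Proof.
move=> [_ [tau [f [tauP fP fnz f_int]]]] k4.
exists [set e | `|f e| == 2]%SET; apply/one_factor_three_edges =>
  v e1 e2 e3 hu hv.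
have [+ gf] := flow_dominates tauP fP fnz hu hv; rewrite !inE -!gf.
move=> /all_and2[g1 gr] h.
have k4R : k%:R <= 4 :> R by rewrite ler_nat.
have /fin_all_exists[n nE] e : exists n, `|inflow tau f v e| = n%:R.
  by apply/natrP; rewrite gf natr_norm_int.
have n13 e : (1 <= n e <= 3)%N.
  by rewrite -!(ler_nat R) -nE g1 (le_trans (gr e)) //; lra.
rewrite !nE -![2]/(2%:R) !eqr_nat.
by case: h => -[+ _ _]; rewrite !nE -natrD => /eqP; rewrite eqr_nat => /eqP;
  move: (n13 e1) (n13 e2) (n13 e3); clear; lia.
Qed.

(** With r <= 3 the values at a vertex are 2, 1 and 1 in absolute value, the 2
    being opposite to the others. Let s v be the common sign of the
    1-edges. At every edge the half-edge sign agrees with s exactly when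
    |f e| = 1, which holds at both ends or at neither; so e is positive
    exactly when s differs at its ends. *)
Lemma cut_of_flow_le3 sigma r : admits_nz_flow sigma r -> r <= 3 ->
  exists S, forall e, in_cut S e = (sigma e == 1).
Proof.
move=> [_ [tau [f [tauP fP fnz]]]] r3.
suff /choice[s sP] : forall v, exists s, forall e, e \in edges_at v ->
    (0 < inflow tau f v e) = s (+) (`|f e| == 2).
  exists [set v | s v]%SET => e; rewrite /in_cut !inE.
  have := sP _ _ (gend_edges_at e false); have := sP _ _ (gend_edges_at e true).
  rewrite /inflow !side_gend; have [tau1 /(_ e) tau2] := tauP.
  have -> : sigma e = - (tau (e, false) * tau (e, true)) by rewrite tau2 opprK.
  have := fnz e; case: (ltgtP (f e) 0) => // fe _;
  case: (tau1 (e, false)) => ->; case: (tau1 (e, true)) => ->;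
  rewrite ?mulrN1z ?mul1r ?mulN1r ?oppr_gt0 ?fe ?(lt_gtF fe);
  by case: (s _); case: (s _); case: (`|f e| == 2).
move=> v; have [e1 [e2 [e3 [hu hv]]]] := three_edges v.
have [+ gf] := flow_dominates tauP fP fnz hu hv.
set g := inflow tau f v => /all_and2[g1 gr] h.
have unit (x y z : R) : dominates x y z -> 1 <= `|y| -> 1 <= `|z| ->
    `|x| <= r - 1 ->
    [/\ (0 < x) = (0 < y) (+) (`|x| == 2), (0 < y) = (0 < y) (+) (`|y| == 2)
      & (0 < z) = (0 < y) (+) (`|z| == 2)].
  move=> [xE yx zx] y1 z1 xr; rewrite zx yx.
  have -> : `|x| = 2 by lra.
  have -> : `|y| = 1 by lra.
  have -> : `|z| = 1 by lra.
  by rewrite eqxx [1 == 2]lt_eqF ?ltr1n // !addbF addbT negbK.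
have [s [s1 s2 s3]] : exists s, [/\ (0 < g e1) = s (+) (`|g e1| == 2),
    (0 < g e2) = s (+) (`|g e2| == 2) & (0 < g e3) = s (+) (`|g e3| == 2)].
  by case: h => /unit[] //; [exists (0 < g e2) | exists (0 < g e1)
    | exists (0 < g e1)].
by exists s => e; rewrite hv !inE -gf => /or3P[]/eqP->.
Qed.

(** * Flows from a one-factor and a matching *)

Section MatchingFlow.
Variables M N : {set edge G}.
Hypotheses (M_factor : one_factor M) (NM : forall e, e \in N -> e \notin M)
  (N_matching : forall v e d, e \in N -> d \in N ->
     e \in edges_at v -> d \in edges_at v -> e = d).

Definition covered v := [exists e in N, e \in edges_at v].

Definition matching_weight e : nat :=
  if e \in M then 2 else if e \in N then 3 else 1.

Definition matching_flow e : R := (matching_weight e)%:R.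

(** N is the set of edges of value 3. At a covered vertex the values balance
    as 1 + 2 = 3, elsewhere as 1 + 1 = 2; the orientation below puts a minus
    sign on the edge that stands alone. *)
Definition matching_orientation (h : half_edge G) : int :=
  if h.1 \in M then if covered (gend h.1 h.2) then 1 else -1
  else if h.1 \in N then -1 else 1.

Definition matching_signature e : int :=
  - (matching_orientation (e, false) * matching_orientation (e, true)).

Lemma matching_orientation_sign h :
  matching_orientation h = 1 \/ matching_orientation h = -1.
Proof. by rewrite /matching_orientation; repeat case: ifP => _; auto. Qed.

Lemma matching_signature_sign : is_signature matching_signature.
Proof.
move=> e; rewrite /matching_signature.
case: (matching_orientation_sign (e, false)) => ->;
case: (matching_orientation_sign (e, true)) => ->;
  rewrite ?mulrNN ?mulr1 ?mul1r ?opprK; by [left | right].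
Qed.

Lemma matching_orientationP :
  is_orientation matching_signature matching_orientation.
Proof.
by split=> [|e]; [exact: matching_orientation_sign|];
  rewrite /matching_signature opprK.
Qed.

Lemma matching_signature_eq1 e : (matching_signature e == 1) =
  (e \in M) && (covered (gend e false) (+) covered (gend e true)).
Proof.
by rewrite /matching_signature /matching_orientation /=; case: (e \in M);
  case: (e \in N); do 2 case: (covered _).
Qed.

Lemma matching_flow_boundary v :
  boundary matching_orientation matching_flow v = 0.
Proof.
have [e1 [e2 [e3 [hu hv]]]] := three_edges v.
have v1 : e1 \in edges_at v by rewrite hv !inE eqxx.
have v2 : e2 \in edges_at v by rewrite hv !inE eqxx ?orbT.
have v3 : e3 \in edges_at v by rewrite hv !inE eqxx ?orbT.
have cov : covered v = [|| e1 \in N, e2 \in N | e3 \in N].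
  apply/exists_inP/or3P => [[e eN]|]; last by case=> ?;
    [exists e1 | exists e2 | exists e3].
  by rewrite hv !inE => /or3P[]/eqP eE; move: eN; rewrite eE;
    [constructor 1 | constructor 2 | constructor 3].
rewrite (boundary_three_edges _ _ hu hv) /matching_orientation /matching_flow
  /matching_weight /=
  (gend_side v1) (gend_side v2) (gend_side v3) cov.
have := (one_factor_three_edges M).2 M_factor v e1 e2 e3 hu hv.
move: hu; rewrite /= !inE negb_or andbT => /andP[/andP[e12 e13] e23].
have dis e d : e != d -> e \in edges_at v -> d \in edges_at v ->
    ~~ ((e \in N) && (d \in N)).
  move=> ed ev dv; apply: contra ed => /andP[eN dN].
  by apply/eqP; apply: N_matching eN dN ev dv.
move: (dis _ _ e12 v1 v2) (dis _ _ e13 v1 v3) (dis _ _ e23 v2 v3).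
have NM' e : ~~ ((e \in N) && (e \in M)).
  by apply/negP => /andP[/NM/negP].
move: (NM' e1) (NM' e2) (NM' e3).
case: (e1 \in M); case: (e2 \in M); case: (e3 \in M) => //;
case: (e1 \in N) => //; case: (e2 \in N) => //; case: (e3 \in N) => //;
move=> _ _ _ _ _ _ _;
rewrite /= ?mulrN1z ?mulr1z; lra.
Qed.

Lemma matching_flow_admits k :
  (2 <= k)%N -> (forall e, matching_weight e < k)%N ->
  admits_int_nz_flow R matching_signature k.
Proof.
move=> k2 wk; split; first by rewrite ler_nat.
exists matching_orientation, matching_flow; split.
- exact: matching_orientationP.
- split; last exact: matching_flow_boundary.
  move=> e; right; rewrite normr_nat ler1n lerBrDr natr1 ler_nat wk andbT.
  by rewrite /matching_weight; case: (e \in M); case: (e \in N).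
- by move=> e; rewrite pnatr_eq0 /matching_weight; case: (e \in M);
  case: (e \in N).
- by move=> e; rewrite /matching_flow intr_nat.
Qed.

End MatchingFlow.

Lemma admits_nz_flow_of_int sigma k :
  admits_int_nz_flow R sigma k -> admits_nz_flow sigma (k%:R : R).
Proof. by move=> [k2 [tau [f [? ? ? _]]]]; split=> //; exists tau, f. Qed.

Lemma int_3_flow_of_one_factor (M : {set edge G}) : one_factor M ->
  exists sigma, is_signature sigma /\ admits_int_nz_flow R sigma 3.
Proof.
move=> M_factor; exists (matching_signature M finset.set0); split.
  exact: matching_signature_sign.
apply: matching_flow_admits => // [e|v' e d|e]; rewrite ?inE //.
by rewrite /matching_weight inE; case: ifP.
Qed.

Lemma uncut_int_4_flow (M : {set edge G}) e0 : one_factor M -> e0 \notin M ->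
  (forall S : {set vertex G}, ~ forall e, in_cut S e = switch_set M e0 e) ->
  exists sigma, [/\ is_signature sigma, admits_int_nz_flow R sigma 4 &
    forall r, admits_nz_flow sigma r -> ~ r <= 3].
Proof.
move=> M_factor e0M nocut; pose N := [set e0]%SET.
exists (matching_signature M N); split.
- exact: matching_signature_sign.
- apply: matching_flow_admits => // [e|v e d|e].
  + by rewrite inE => /eqP->.
  + by rewrite !inE => /eqP-> /eqP->.
  + by rewrite /matching_weight; case: (e \in M); case: (e \in N).
- move=> r r_flow r3; have [S hS] := cut_of_flow_le3 r_flow r3.
  apply: (nocut S) => e; rewrite hS matching_signature_eq1 /switch_set.
  have cov v : covered N v = (v \in ends e0).
    rewrite mem_ends; apply/exists_inP/idP => [[e' /set1P->]//|].
    by exists e0 => //; exact: set11.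
  by rewrite !cov.
Qed.

Lemma in_integer_flow_spectrum sigma k : is_signature sigma ->
  admits_int_nz_flow R sigma k ->
  (forall j, admits_int_nz_flow R sigma j -> (k <= j)%N) ->
  k \in integer_flow_spectrum R G.
Proof.
move=> s1 sk smin; apply/mem_set; exists sigma; split=> //.
by exists k%:R; exact: admits_nz_flow_of_int.
Qed.

(** The vertex v only witnesses that the graph is not empty: an empty graph
    has 2-flows. *)
Lemma circular_flow_number3 sigma v : admits_nz_flow sigma (3 : R) ->
  circular_flow_number R sigma = 3%:E.
Proof.
move=> s3; apply/eqP; rewrite eq_le; apply/andP; split.
  by apply: ereal_inf_lbound; exists 3.
apply: le_ereal_inf_tmp => _ [r r_flow <-].
by rewrite lee_fin; exact: nz_flow_ge3 v r_flow.
Qed.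

End Flows.

Theorem theorem6p5 (R : realType) (G : graph)
    (hcubic : cubic G)
    (hK23 : ~ graph_iso G K23)
    (* G is neither empty nor a disconnected union of copies of K_2^3 *)
    (hcopies : forall n : nat, n <> 1%N -> ~ graph_iso G (copies n K23)) :
  [<-> has_one_factor G;
       3%:R \in flow_spectrum R G;
       3%N \in integer_flow_spectrum R G;
       4%N \in integer_flow_spectrum R G].
Proof.
have flow3 : has_one_factor G ->
    3%:R \in flow_spectrum R G /\ 3%N \in integer_flow_spectrum R G.
  move=> G_factor.
  have [M [e0 [M_factor _ _]]] :=
    exists_uncut_switch_set hcubic hK23 hcopies G_factor.
  pose v := gend e0 false.
  have [sigma [s1 s3]] := int_3_flow_of_one_factor R hcubic M_factor.
  have s3' := admits_nz_flow_of_int s3; split.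
    apply/mem_set; exists sigma; split=> //; first by exists 3.
    exact: circular_flow_number3 hcubic _ v s3'.
  apply: in_integer_flow_spectrum s1 s3 _ => j /admits_nz_flow_of_int sj.
  by rewrite -(ler_nat R); exact: nz_flow_ge3 v sj.
tfae.
- by case/flow3.
- move=> /set_mem[sigma [_ _ s3]].
  have : (circular_flow_number R sigma < 4%:E)%E by rewrite s3 lte_fin ltr_nat.
  move=> /ereal_inf_lt[_ [r r_flow <-]]; rewrite lte_fin => r4.
  by have [] := flow3 (one_factor_of_flow_lt4 hcubic r_flow r4).
- move=> /set_mem[sigma [_ _ [s3 _]]].
  have G_factor := one_factor_of_int_flow_le4 hcubic s3 isT.
  have [M [e0 [M_factor e0M nocut]]] :=
    exists_uncut_switch_set hcubic hK23 hcopies G_factor.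
  have [sigma4 [s1 s4 no3]] := uncut_int_4_flow R hcubic M_factor e0M nocut.
  apply: in_integer_flow_spectrum s1 s4 _ => j /admits_nz_flow_of_int sj.
  by rewrite ltnNge; apply/negP => j3; apply: no3 sj _; rewrite ler_nat.
- move=> /set_mem[sigma [_ _ [s4 _]]].
  exact (one_factor_of_int_flow_le4 hcubic s4 (leqnn 4)).
Qed.
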